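(* Let $p$ be an odd prime and let $G$ be a finite non-abelian $p$-group. (1) If $|G| = p^3$, then $\mathrm{cod}(G) = \{ 1, p, p^2 \}$. (2) If $|G| = p^4$, then $\mathrm{cod}(G)$ is one of the sets $\{1, p, p^2\}$, $\{1, p, p^3\}$, $\{1, p, p^2, p^3\}$. (3) If $|G| = p^5$, then $\mathrm{cod}(G)$ is one of the sets $\{1, p, p^2\}$, $\{1, p, p^3\}$, $\{1, p, p^2, p^3\}$, $\{1, p, p^2, p^4\}$, $\{1, p, p^2, p^3, p^4\}$.
   Context: For an irreducible complex character $\chi$ of a finite group $G$, its codegree is $\mathrm{cod}(\chi) = |G:\ker\chi|/\chi(1)$, and $\mathrm{cod}(G) = \{\mathrm{cod}(\chi) : \chi \in \mathrm{Irr}(G)\}$. *)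

(* Defs.v *)
From mathcomp Require Import all_boot all_order all_algebra all_fingroup.
From mathcomp Require Import all_solvable all_field all_character.

Set Implicit Arguments.
Unset Strict Implicit.
Unset Printing Implicit Defensive.

Import GRing.Theory.
Local Open Scope ring_scope.

(* Irreducible characters take values in algC, which is no restriction for
   complex characters of a finite group. *)
Definition codegree (gT : finGroupType) (G : {group gT}) (chi : 'CF(G)) : algC :=
  (#|G : cfker chi|%g)%:R / chi 1%g.

(* As a sequence this may contain repetitions, so it should only be used
   through its membership predicate, i.e., compared with =i. *)
Definition cod_set (gT : finGroupType) (G : {group gT}) : seq algC :=
  [seq codegree 'chi[G]_i | i : Iirr G].

(* Main.v *)
(** Every codegree is a power [p^c] with [c < n], where [|G| = p^n]; [1] and [p]
    always occur, and a nonlinear character gives some [c >= 2].  This settles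
    everything except the exclusion, for [n = 5], of sets containing [p^4] but
    not [p^2].  A cyclic quotient of order [p^2] (which exists unless [G/G']
    is elementary abelian) or a nonabelian quotient of order [p^3] gives the
    codegree [p^2].

    A nonlinear character of codegree [p^4] is faithful of degree [p], so [Z(G)]
    is cyclic.  We may assume that [G/G'] is elementary abelian.
    - If [G' <= Z(G)], then [|G : Z(G)| = p^2], so [Z(G)] is cyclic of order
      [p^3]; but class 2 forces [G'], hence [G], to have exponents [p], [p^2].
    - Otherwise [|Z(G)|] is [p^2] or [p].  In the first case [G/Z(G)] is
      nonabelian of order [p^3].  In the second, [G] has an abelian subgroup [A]
      of index [p], so [|G'| >= |A : Z(G)| = p^3], and for [N] normal of index
      [p] in [G'], the quotient [G/N] is nonabelian of order [p^3]. *)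

Require Import Defs.
From mathcomp Require Import all_boot all_order all_algebra all_fingroup.
From mathcomp Require Import all_solvable all_field all_character.
From mathcomp Require Import zify.

Set Implicit Arguments.
Unset Strict Implicit.
Unset Printing Implicit Defensive.

Import GRing.Theory Num.Theory.
Local Open Scope ring_scope.

(** * Normal subgroups and irreducible characters of p-groups *)

Lemma pgroup_normal_between (gT : finGroupType) (p r : nat)
    (G K : {group gT}) :
  prime p -> (p.-group G)%g -> (K <| G)%g -> (p ^ r %| #|G : K|%g)%N ->
  exists N : {group gT},
    [/\ K \subset N, (N <| G)%g & #|G : N|%g = (p ^ r)%N].
Proof.
move=> p_pr pG nKG dvd_r; have [sKG nKG'] := andP nKG.
have pGK : (p.-group (G / K))%g by apply: quotient_pgroup.
have [m cardGK] : exists m, #|(G / K)%g| = (p ^ m)%N.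
  by have [m ->] := p_natP pGK; exists m.
move: dvd_r; rewrite -card_quotient // cardGK dvdn_Pexp2l ?prime_gt1 // => le_rm.
(* A normal subgroup of order [p ^ (m - r)] in [G / K] pulls back to one of index [p ^ r] in [G]. *)
have [|Q [_ nQ cardQ]] := normal_pgroup (r := m - r) pGK (normal_refl _).
  by rewrite cardGK pfactorK // leq_subr.
have [N defQ sKN nNG] := inv_quotientN nKG nQ.
exists N; split=> //.
have sNG := normal_sub nNG.
rewrite -(@index_quotient_eq _ G K N) //; last by rewrite subIset // sKN orbT.
rewrite -defQ -divgS ?(normal_sub nQ) // cardGK cardQ -expnB ?prime_gt0 //.
  by rewrite subKn.
exact: leq_subr.
Qed.

(** A normal subgroup is the intersection of the irreducible kernels containing it. *)
Lemma irr_kernel_separation (gT : finGroupType) (G N : {group gT}) (x : gT) :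
  (N <| G)%g -> x \notin N ->
  exists i : Iirr G, N \subset cfker 'chi_i /\ x \notin cfker 'chi_i.
Proof.
move=> nNG xN.
have: x \notin (\bigcap_(i : Iirr G | N \subset cfker 'chi_i) cfker 'chi_i)%g.
  by rewrite cap_cfker_normal.
case: (boolP [exists i : Iirr G,
  (N \subset cfker 'chi_i) && (x \notin cfker 'chi_i)]).
  by case/existsP=> i /andP[? ?] _; exists i.
rewrite negb_exists => /forallP sepN /bigcapP[] i sNi.
by have := sepN i; rewrite sNi negbK.
Qed.

(* For the strict bound, [chi(1)^2 <= |G : Z(chi)|], and [Z(chi) / ker chi] is
   the centre of a nontrivial p-group. *)
Lemma irr_pgroup_shape (p : nat) (gT : finGroupType) (G : {group gT})
    (i : Iirr G) :
  prime p -> (p.-group G)%g ->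
  exists k e : nat,
    [/\ #|G : cfker 'chi_i|%g = (p ^ k)%N, 'chi_i 1%g = (p ^ e)%N%:R,
        codegree 'chi_i = p%:R ^+ (k - e) & i != 0 -> (e.*2 < k)%N].
Proof.
move=> p_pr pG.
have [n cardG] := p_natP pG.
have [k _ idx] : exists2 k, (k <= n)%N & #|G : cfker 'chi_i|%g = (p ^ k)%N.
  by apply/(dvdn_pfactor _ _ p_pr); rewrite -cardG dvdn_indexg.
have [d deg] := natrP (Cnat_irr1 i).
have [e _ def_d] : exists2 e, (e <= n)%N & d = (p ^ e)%N.
  apply/(dvdn_pfactor _ _ p_pr).
  by have := dvd_irr1_cardG i; rewrite deg dvdC_nat cardG.
rewrite {d}def_d in deg.
have i0P : i != 0 -> (e.*2 < k)%N.
  move=> i_nz; rewrite -(@ltn_exp2l p) ?prime_gt1 //.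
  have nKG := cfker_normal 'chi_i.
  have sKZ := cfker_center_normal 'chi_i.
  have le1 : ((p ^ e) ^ 2 <= #|G : 'Z('chi_i)%CF|%g)%N.
    by rewrite -(ler_nat algC) natrX -deg (irr1_bound i).
  rewrite -muln2 expnM; apply: leq_ltn_trans le1 _.
  have sZG := cfcenter_sub 'chi_i.
  rewrite -idx -(Lagrange_index sZG (normal_sub sKZ)) -[X in (X < _)%N]muln1.
  rewrite ltn_pmul2l ?indexg_gt0 // indexg_gt1.
  apply: contra i_nz => sZK.
  have : ('Z(G / cfker 'chi_i) == 1)%g.
    by rewrite -cfcenter_eq_center -subG1 quotient_sub1 // normal_norm.
  rewrite center_nil_eq1; last first.
    exact: pgroup_nil (quotient_pgroup _ pG).
  rewrite -subG1 quotient_sub1 ?normal_norm // => sGK.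
  by rewrite -subGcfker.
exists k, e; split=> //.
(* Subtraction on [nat] truncates, so [p ^ k / p ^ e] is [p ^ (k - e)] only once [e <= k]. *)
have le_ek : (e <= k)%N.
  have [i0 | /i0P] := eqVneq i 0.
    move: deg; rewrite i0 irr0 cfun11 => /eqP; rewrite eq_sym pnatr_eq1.
    by rewrite -(expn0 p) eqn_exp2l ?prime_gt1 // => /eqP->.
  by rewrite -addnn => /ltnW; apply: leq_trans; apply: leq_addr.
rewrite /codegree idx deg !natrX exprB // unitfE pnatr_eq0.
by rewrite -lt0n prime_gt0.
Qed.

(** * Nonlinear characters and an abelian subgroup of index [p] *)

Lemma prime_dvd_nonlinear_irr1 (p : nat) (gT : finGroupType) (G : {group gT})
    (i : Iirr G) :
  prime p -> (p.-group G)%g -> 'chi_i \isn't a linear_char ->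
  (p %| 'chi_i 1%g)%C.
Proof.
move=> p_pr pG nlin; have [k [e [_ deg _ _]]] := irr_pgroup_shape i p_pr pG.
rewrite deg dvdC_nat; case: e deg => [|e] deg; last by rewrite expnS dvdn_mulr.
by rewrite qualifE /= irr_char deg eqxx in nlin.
Qed.

(* The principal character occurs just once in [chi * chi^*], so [p] divides the
   number of linear constituents; any of them fixes [chi] under multiplication. *)
Lemma nonlinear_irr_eq0_off_linear_cfker (p : nat) (gT : finGroupType)
    (G : {group gT}) (i : Iirr G) :
  prime p -> (p.-group G)%g -> 'chi_i \isn't a linear_char ->
  exists j : Iirr G, [/\ j != 0, 'chi_j \is a linear_char
    & forall x, x \notin cfker 'chi_j -> 'chi_i x = 0].
Proof.
move=> p_pr pG nlin; pose phi := 'chi_i * ('chi_i)^*%CF.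
have Nphi : phi \is a character.
  by rewrite rpredM ?irr_char //= cfAut_char irr_char.
have dotE j : '[phi, 'chi_j] = '['chi_i, 'chi_i * 'chi_j].
  rewrite !cfdotE; congr (_ * _); apply: eq_bigr => x _.
  by rewrite !cfunE /= rmorphM mulrA.
have [/existsP[j /and3P[nz_j lin_j dot_j]] | /existsPn no_j] := boolP
    [exists j, [&& j != 0, 'chi_j \is a linear_char & '[phi, 'chi_j] != 0]].
  exists j; split=> // x notKx.
  have /irrP[l def_l] : 'chi_i * 'chi_j \in irr G.
    by rewrite mulrC mul_lin_irr ?mem_irr.
  have eq_il : 'chi_i = 'chi_i * 'chi_j.
    move: dot_j; rewrite dotE def_l cfdot_irr.
    by have [-> | _] := eqVneq i l; rewrite ?eqxx.
  have [Gx|notGx] := boolP (x \in G); last by rewrite cfun0.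
  have /eqP := congr1 (fun f : 'CF(G) => f x) eq_il.
  rewrite !cfunE -{1}['chi_i x]mulr1 -subr_eq0 -mulrBr mulf_eq0 => /orP[/eqP//|].
  rewrite subr_eq0 eq_sym => /eqP lx1; case/negP: notKx.
  by rewrite cfkerEirr inE lx1 lin_char1.
have: (p %| phi 1%g)%C.
  rewrite cfunE; apply: dvdC_mulr; last exact: prime_dvd_nonlinear_irr1.
  by rewrite intr_nat // Cnat_char1 ?cfAut_char ?irr_char.
(* The principal character contributes exactly 1 to the degree; if all other terms are divisible by
   [p], then so is 1. *)
rewrite {1}(cfun_sum_cfdot phi) sum_cfunE (bigD1 0) //= rpredDr.
  rewrite cfunE dotE irr0 mulr1 cfnorm_irr mul1r cfun11 (dvdC_nat p 1) dvdn1.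
  by case: eqP p_pr => // ->.
apply: rpred_sum => j nz_j; rewrite cfunE.
have [lin_j | nlin_j] := boolP ('chi_j \is a linear_char).
  by have := no_j j; rewrite nz_j lin_j negbK => /eqP->; rewrite mul0r rpred0.
apply: dvdC_mull; last exact: prime_dvd_nonlinear_irr1.
by rewrite intr_nat // Cnat_cfdot_char ?irr_char.
Qed.

(** Take [A] above the kernel of a linear character off which [chi] vanishes. The restriction of
    [chi] to [A] then has norm [p]. A nonlinear constituent would have degree at least [p], hence be
    the whole restriction, of norm 1. So all constituents are linear and [A'] lies in the trivial
    kernel of [chi]. *)
Lemma faithful_irr_degree_p_abelian_index_p (p : nat) (gT : finGroupType)
    (G : {group gT}) (i : Iirr G) :
  prime p -> (p.-group G)%g -> cfaithful 'chi_i -> 'chi_i 1%g = p%:R ->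
  exists A : {group gT}, [/\ (A <| G)%g, #|G : A|%g = p & abelian A].
Proof.
move=> p_pr pG ffi deg.
have nlin : 'chi_i \isn't a linear_char.
  rewrite qualifE /= irr_char deg pnatr_eq1.
  by case: eqP p_pr => // ->.
have [j [nz_j _ off_j]] := nonlinear_irr_eq0_off_linear_cfker p_pr pG nlin.
have [n idxG] : exists n, #|G : cfker 'chi_j|%g = (p ^ n)%N.
  have [k [_ [-> _ _ _]]] := irr_pgroup_shape j p_pr pG.
  by exists k.
have n_gt0 : (0 < n)%N.
  rewrite lt0n; apply: contraNneq nz_j => n0; rewrite -subGcfker -indexg_eq1.
  by rewrite idxG n0.
have [|A [sKA nAG idxA]] :=
    pgroup_normal_between (r := 1) p_pr pG (cfker_normal 'chi_j).
  by rewrite idxG dvdn_Pexp2l ?prime_gt1.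
rewrite expn1 in idxA; exists A; split=> //.
have sAG := normal_sub nAG.
have NRes : 'Res[A] 'chi_i \is a character by rewrite cfRes_char ?irr_char.
have normRes : '['Res[A] 'chi_i] = p%:R.
  (* The norm of a restriction is at most [#|G : A|] times the original norm, with equality for
     characters vanishing off [A]. *)
  have [_] := cfnorm_Res_leif 'chi_i sAG.
  have -> : 'chi_i \in 'CF(G, A).
    apply/cfun_onP => x notAx; apply: off_j.
    by apply: contra notAx; apply: (subsetP sKA).
  by move/eqP->; rewrite cfnorm_irr mulr1 idxA.
have derA : (A^`(1) \subset cfker 'chi_i)%g.
  apply: subset_trans (_ : cfker ('Res[A] 'chi_i) \subset _).
    rewrite cfkerE // subsetI der_sub; apply/bigcapsP => k constt_k.
    rewrite -lin_irr_der1; have [c1 Nc1 def_Res] := constt_charP k NRes constt_k.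
    have pA := pgroupS sAG pG.
    have [//| nlin_k] := boolP ('chi_k \is a linear_char).
    have := prime_dvd_nonlinear_irr1 p_pr pA nlin_k.
    have [d def_d] := natrP (Cnat_irr1 k).
    have [d1 def_d1] := natrP (Cnat_char1 Nc1).
    rewrite def_d dvdC_nat => /dvdn_leq le_pd.
    have d_gt0 : (0 < d)%N by rewrite -(ltr_nat algC) -def_d irr1_gt0.
    have def_p : p = (d + d1)%N.
      apply/eqP; rewrite -(eqr_nat algC) natrD -def_d -def_d1 -deg.
      by rewrite -(cfRes1 A) def_Res cfunE.
    have d1_0 : d1 = 0%N.
      by apply/eqP; rewrite -leqn0 -(leq_add2l d) addn0 -def_p le_pd.
    have c1_0 : c1 = 0 by apply/eqP; rewrite -char1_eq0 // def_d1 d1_0.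
    move: normRes; rewrite def_Res c1_0 addr0 cfnorm_irr => /esym/eqP.
    by rewrite pnatr_eq1; case: eqP p_pr => // ->.
  apply/subsetP => x; rewrite cfkerEchar // cfkerEirr !inE => /andP[Ax].
  by rewrite cfResE // cfRes1.
by rewrite (sameP derG1P trivgP) (subset_trans derA).
Qed.

(** * Codegrees [p] and [p ^ 2] from small quotients *)

(** For [r <= 3] the bounds [e.*2 < k <= r] leave so few pairs [(k, e)] that mild extra information
    fixes the codegree. *)
Lemma pgroup_separating_irr (p r : nat) (gT : finGroupType) (G N : {group gT})
    (x : gT) :
  prime p -> (p.-group G)%g -> (N <| G)%g -> (#|G : N|%g %| p ^ r)%N ->
  x \in G -> x \notin N ->
  exists (i : Iirr G) (k e : nat),
    [/\ #|G : cfker 'chi_i|%g = (p ^ k)%N, 'chi_i 1%g = (p ^ e)%N%:R,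
        codegree 'chi_i = p%:R ^+ (k - e), (e.*2 < k <= r)%N
      & x \notin cfker 'chi_i].
Proof.
move=> p_pr pG nNG dvd_r Gx Nx.
have [i [sNK Kx]] := irr_kernel_separation nNG Nx.
have [k [e [idx deg cod lt_ek]]] := irr_pgroup_shape i p_pr pG.
exists i, k, e; split=> //; rewrite lt_ek /=; last first.
  by apply: contraNneq Kx => ->; rewrite cfker_irr0.
rewrite -(@dvdn_Pexp2l p) ?prime_gt1 // -idx.
exact: dvdn_trans (indexgS G sNK) dvd_r.
Qed.

Lemma codegree_in_cod_set (gT : finGroupType) (G : {group gT}) (i : Iirr G) :
  codegree 'chi_i \in cod_set G.
Proof. exact: image_f. Qed.

Lemma p_in_cod_set (p : nat) (gT : finGroupType) (G : {group gT}) :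
  prime p -> (p.-group G)%g -> ~~ abelian G -> p%:R \in cod_set G.
Proof.
move=> p_pr pG nabG.
have ntG : G :!=: 1%g by apply: contraNneq nabG => ->; apply: abelian1.
have [_ dvd_p _] := pgroup_pdiv pG ntG.
have dvd_p1 : (p ^ 1 %| #|G : 1|%g)%N by rewrite indexg1.
have [N [_ nNG idxN]] := pgroup_normal_between p_pr pG (normal1 G) dvd_p1.
have dvd_idx : (#|G : N|%g %| p ^ 1)%N by rewrite idxN.
have /subsetPn[x Gx Nx] : ~~ (G \subset N).
  by rewrite -indexg_eq1 idxN expn1; case: eqP p_pr => // ->.
have [i [k [e [_ _ cod lt_ek _]]]] :=
  pgroup_separating_irr p_pr pG nNG dvd_idx Gx Nx.
have [k1 e0] : k = 1%N /\ e = 0%N by lia.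
by have := codegree_in_cod_set i; rewrite cod k1 e0 expr1.
Qed.

Lemma expg_mem_normal_index_dvd (gT : finGroupType) (G N : {group gT})
    (x : gT) (m : nat) :
  (N <| G)%g -> (#|G : N|%g %| m)%N -> x \in G -> (x ^+ m)%g \in N.
Proof.
move=> nNG dvd_m Gx; have nNx := subsetP (normal_norm nNG) x Gx.
rewrite coset_idr ?groupX // morphX //; apply/eqP; rewrite -order_dvdn.
apply: dvdn_trans (order_dvdG (mem_quotient _ Gx)) _.
by rewrite card_quotient ?normal_norm.
Qed.

(** A character separating [x ^+ p] from [N] cannot have a kernel of index [p], since that kernel
    would contain [x ^+ p]. *)
Lemma p2_in_cod_set_cyclic_quotient (p : nat) (gT : finGroupType)
    (G N : {group gT}) (x : gT) :
  prime p -> (p.-group G)%g -> (N <| G)%g -> #|G : N|%g = (p ^ 2)%N ->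
  x \in G -> (x ^+ p)%g \notin N -> p%:R ^+ 2 \in cod_set G.
Proof.
move=> p_pr pG nNG idxN Gx Nxp.
have dvd_idx : (#|G : N|%g %| p ^ 2)%N by rewrite idxN.
have [i [k [e [idx _ cod lt_ek Kxp]]]] :=
  pgroup_separating_irr p_pr pG nNG dvd_idx (groupX p Gx) Nxp.
have k_gt1 : (1 < k)%N.
  rewrite ltnNge; apply: contra Kxp => le_k1.
  apply: (expg_mem_normal_index_dvd (cfker_normal 'chi_i) _ Gx).
  by rewrite idx (@dvdn_Pexp2l p k 1) ?prime_gt1.
have [k2 e0] : k = 2%N /\ e = 0%N.
  by lia.
by have := codegree_in_cod_set i; rewrite cod k2 e0.
Qed.

(** A character nontrivial on an element of [G'] is nonlinear, and index at most [p ^ 3] then forces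
    [k = 3] and [e = 1]. *)
Lemma p2_in_cod_set_nonabelian_quotient (p : nat) (gT : finGroupType)
    (G N : {group gT}) :
  prime p -> (p.-group G)%g -> (N <| G)%g -> (#|G : N|%g %| p ^ 3)%N ->
  ~~ (G^`(1) \subset N)%g -> p%:R ^+ 2 \in cod_set G.
Proof.
move=> p_pr pG nNG dvd3 /subsetPn[x G'x Nx].
have Gx : x \in G by apply: subsetP G'x; apply: der_sub.
have [i [k [e [_ deg cod lt_ek Kx]]]] :=
  pgroup_separating_irr p_pr pG nNG dvd3 Gx Nx.
have e_gt0 : (0 < e)%N.
  rewrite lt0n; apply: contra Kx => /eqP e0; apply: subsetP G'x.
  by rewrite -lin_irr_der1 qualifE /= irr_char deg e0 expn0 eqxx.
have [k3 e1] : k = 3 /\ e = 1%N.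
  by lia.
by have := codegree_in_cod_set i; rewrite cod k3 e1.
Qed.

Lemma p2_in_cod_set_linear (p : nat) (gT : finGroupType)
    (G : {group gT}) (i : Iirr G) :
  prime p -> (p.-group G)%g -> 'chi_i \is a linear_char ->
  (p ^ 2 %| #|G : cfker 'chi_i|%g)%N -> p%:R ^+ 2 \in cod_set G.
Proof.
move=> p_pr pG lin_i dvd2; have nKG := cfker_normal 'chi_i.
have cycGK : cyclic (G / cfker 'chi_i).
  have := cfcenter_cyclic 'chi_i; rewrite cfcenter_eq_center.
  suff /center_idP -> : abelian (G / cfker 'chi_i) by [].
  by rewrite sub_der1_abelian // -lin_irr_der1.
have [N [sKN nNG idxN]] := pgroup_normal_between p_pr pG nKG dvd2.
have cycGN : cyclic (G / N).
  by rewrite -(isog_cyclic (third_isog sKN nKG nNG)) quotient_cyclic.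
have [yb def_GN] := cyclicP cycGN.
have /morphimP[y nNy Gy def_yb] : yb \in (G / N)%g by rewrite def_GN cycle_id.
apply: (p2_in_cod_set_cyclic_quotient p_pr pG nNG idxN Gy).
(* The image of [y] generates [G / N], so its order is [p ^ 2]. *)
apply/negP => Nyp; have: (#[yb]%g %| p)%N.
  by rewrite order_dvdn def_yb -morphX //= coset_id.
rewrite orderE -def_GN card_quotient ?normal_norm // idxN.
by rewrite (dvdn_Pexp2l 2 1 (prime_gt1 p_pr)).
Qed.

Lemma p2_in_cod_set_abelianization (p : nat) (gT : finGroupType)
    (G : {group gT}) (x : gT) :
  prime p -> (p.-group G)%g -> x \in G -> (x ^+ p)%g \notin (G^`(1))%g ->
  p%:R ^+ 2 \in cod_set G.
Proof.
move=> p_pr pG Gx G'xp.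
have [i [sG'K Kxp]] := irr_kernel_separation (der_normal 1 G) G'xp.
have [k [_ [idx _ _ _]]] := irr_pgroup_shape i p_pr pG.
apply: (p2_in_cod_set_linear p_pr pG (i := i)); first by rewrite lin_irr_der1.
rewrite idx (dvdn_Pexp2l _ _ (prime_gt1 p_pr)) leqNgt; apply: contra Kxp => le_k1.
apply: (expg_mem_normal_index_dvd (cfker_normal 'chi_i) _ Gx).
by rewrite idx (@dvdn_Pexp2l p k 1) ?prime_gt1.
Qed.

(** * The derived subgroup, and why [p ^ 4] brings [p ^ 2] *)

(** In class 2, [[u, v] ^ p = [u ^ p, v] = 1], so the generators of [G'] lie in ['Ohm_1('Z(G))],
    which is elementary abelian. *)
Lemma class2_der1_expg (p : nat) (gT : finGroupType) (G : {group gT}) :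
  prime p -> (p.-group G)%g -> (G^`(1) \subset 'Z(G))%g ->
  (forall x, x \in G -> x ^+ p \in 'Z(G))%g ->
  forall y, (y \in G^`(1) -> y ^+ p = 1)%g.
Proof.
move=> p_pr pG sG'Z ZXp y G'y.
have pZ : (p.-group 'Z(G))%g := pgroupS (center_sub G) pG.
have abO : (p.-abelem 'Ohm_1('Z(G)))%g.
  by rewrite abelem_Ohm1 // (abelianS (Ohm_sub 1 _)) ?center_abelian.
have [_ expO] := abelemP p_pr abO.
apply: expO; apply: subsetP G'y; rewrite gen_subG.
apply/subsetP => _ /imset2P[u v Gu Gv ->].
have Zuv : ([~ u, v] \in 'Z(G))%g by apply: (subsetP sG'Z); apply: mem_commg.
rewrite /= (OhmE 1 pZ) mem_gen //; apply/setIP; split=> //.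
rewrite inE expn1 -commXg; last exact: centerC Zuv.
by apply/commgP/esym; apply: centerC (ZXp u Gu).
Qed.

(* For [x] outside [A], the class of [x] under [A] has [|A : Z(G)|] elements and
   lies in the coset [x G']. *)
Lemma abelian_normal_prime_index_der1 (p : nat) (gT : finGroupType)
    (G A : {group gT}) :
  prime p -> (A <| G)%g -> #|G : A|%g = p -> abelian A ->
  (#|A| <= #|G^`(1)%g| * #|'Z(G)%g|)%N.
Proof.
move=> p_pr nAG idxA abA; have sAG := normal_sub nAG.
have /subsetPn[x Gx Ax] : ~~ (G \subset A).
  by rewrite -indexg_eq1 idxA; case: eqP p_pr => // ->.
have sCZ : ('C_A[x] \subset 'Z(G))%g.
  apply/subsetP => c /setIP[Ac /cent1P cxc]; have Gc := subsetP sAG c Ac.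
  apply/centerP; split=> // y Gy.
  suff: y \in 'C_G[c]%g by case/setIP=> _ /cent1P.
  have sAC : (A \subset 'C_G[c])%g.
    rewrite subsetI sAG; apply/subsetP => a Aa; apply/cent1P.
    by apply: (centsP abA).
  have : (#|G : 'C_G[c]| %| p)%g%N by rewrite -idxA indexgS.
  have Cx : x \in 'C_G[c]%g by rewrite inE Gx; apply/cent1P.
  (* Index [p] would give ['C_G[c] = A], although [x] centralises [c]; so [c] is central in [G]. *)
  case/primeP: (p_pr) => _ /[apply] /orP[|/eqP idxC].
    by rewrite indexg_eq1 => /subsetP; apply.
  case/negP: Ax; have /eqP -> // : A == 'C_G[c]%G :> {set gT}.
  rewrite eqEcard sAC /= -(leq_pmul2r (prime_gt0 p_pr)) -{1}idxC -idxA.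
  by rewrite !Lagrange // subsetIl.
rewrite -(Lagrange (subsetIl A 'C[x]%g)) index_cent1 mulnC.
apply: leq_mul (subset_leq_card sCZ).
rewrite -(card_lcoset (G^`(1))%g x) subset_leq_card //.
apply/subsetP => _ /imsetP[a Aa ->]; rewrite mem_lcoset.
by apply: mem_commg => //; apply: (subsetP sAG).
Qed.

Lemma p4_in_cod_set_p2 (p : nat) (gT : finGroupType) (G : {group gT}) :
  prime p -> #|G| = (p ^ 5)%N -> p%:R ^+ 4 \in cod_set G ->
  p%:R ^+ 2 \in cod_set G.
Proof.
move=> p_pr cardG /imageP[i _ cod_i]; have p_gt1 := prime_gt1 p_pr.
have pG : (p.-group G)%g by rewrite /pgroup cardG pnatX pnat_id.
have [k [e [idx deg cod i0P]]] := irr_pgroup_shape i p_pr pG.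
have ke4 : (k - e = 4)%N.
  apply/eqP; rewrite -(eqn_exp2l _ _ p_gt1) -(eqr_nat algC) !natrX.
  by rewrite -cod -cod_i.
have le_k5 : (k <= 5)%N.
  by rewrite -(dvdn_Pexp2l _ _ p_gt1) -idx -cardG dvdn_indexg.
have [lin_i | nlin_i] := boolP ('chi_i \is a linear_char).
  by apply: p2_in_cod_set_linear lin_i _ => //; rewrite idx dvdn_Pexp2l //; lia.
have e_gt0 : (0 < e)%N.
  rewrite lt0n; apply: contra nlin_i => /eqP e0.
  by rewrite qualifE /= irr_char deg e0 expn0 eqxx.
have [k5 e1] : k = 5 /\ e = 1%N by lia.
rewrite {}k5 in idx; rewrite {}e1 expn1 in deg => {cod ke4 le_k5 e_gt0 i0P k e}.
have ffi : cfaithful 'chi_i.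
  rewrite /cfaithful subG1 trivg_card1 -(eqn_pmul2r (indexg_gt0 G (cfker 'chi_i))).
  by rewrite mul1n Lagrange ?cfker_sub // cardG idx.
have nabG : ~~ (G^`(1) \subset [1])%g.
  by apply: contra nlin_i => sG'1; rewrite lin_irr_der1 (subset_trans sG'1) ?sub1G.
have cycZ := irr_faithful_center ffi.
have [m le_m5 cardZ] : exists2 m, (m <= 5)%N & #|'Z(G)%g| = (p ^ m)%N.
  by apply/(dvdn_pfactor _ _ p_pr); rewrite -cardG cardSg ?center_sub.
have idxZ : #|G : 'Z(G)|%g = (p ^ (5 - m))%N.
  by rewrite -divgS ?center_sub // cardG cardZ -expnB ?prime_gt0.
have [sG'Z | nsG'Z] := boolP (G^`(1) \subset 'Z(G))%g.
  have [/exists_inP[x Gx G'xp] | /exists_inPn elemG] := boolP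
      [exists x in G, (x ^+ p)%g \notin (G^`(1))%g].
    exact: p2_in_cod_set_abelianization G'xp.
  have G'Xp x : x \in G -> (x ^+ p)%g \in (G^`(1))%g.
    by move/elemG; rewrite negbK.
  have expG x : x \in G -> (x ^+ (p ^ 2))%g = 1%g.
    move=> Gx; rewrite expgM; apply: (class2_der1_expg p_pr pG) (G'Xp x Gx) => //.
    by move=> y Gy; apply: (subsetP sG'Z); apply: G'Xp.
  have m3 : m = 3.
    (* When [G / Z(chi)] is abelian, [chi(1) ^ 2 = |G : Z(chi)|]; here this reads
       [p ^ 2 = p ^ (5 - m)]. *)
    have := irr1_abelian_bound (i := i); rewrite cfcenter_fful_irr //.
    rewrite sub_der1_abelian // deg idxZ => /(_ isT)/eqP.
    by rewrite -natrX eqr_nat eqn_exp2l // => /eqP; lia.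
  have [z def_Z] := cyclicP cycZ.
  have : (#[z]%g %| p ^ 2)%N.
    by rewrite order_dvdn expG // (subsetP (center_sub G)) // def_Z cycle_id.
  by rewrite orderE -def_Z cardZ m3 dvdn_Pexp2l.
have m_gt0 : (0 < m)%N.
  rewrite lt0n; apply: contra nabG => /eqP m0.
  have: 'Z(G)%g == 1%g by rewrite trivg_card1 cardZ m0.
  rewrite center_nil_eq1 ?(pgroup_nil pG) // => /eqP G1.
  by apply: subset_trans (der_sub 1 G) _; rewrite G1.
have le_m2 : (m <= 2)%N.
  rewrite leqNgt; apply: contra nsG'Z => lt2m.
  rewrite der1_min ?normal_norm ?center_normal //.
  (* A centre of order at least [p ^ 3] leaves a quotient of order at most [p ^ 2], which is
     abelian. *)
  apply: (p2group_abelian (quotient_pgroup _ pG)).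
  by rewrite card_quotient ?normal_norm ?center_normal // idxZ pfactorK //; lia.
have [m1 | m2] : m = 1%N \/ m = 2 by lia.
  have [A [nAG idxA abA]] := faithful_irr_degree_p_abelian_index_p p_pr pG ffi deg.
  have cardA : #|A| = (p ^ 4)%N.
    apply/eqP; rewrite -(eqn_pmul2r (prime_gt0 p_pr)) -{1}idxA.
    by rewrite Lagrange ?normal_sub // cardG -expnSr.
  have := abelian_normal_prime_index_der1 p_pr nAG idxA abA.
  have [n le_n5 cardG'] : exists2 n, (n <= 5)%N & #|(G^`(1))%g| = (p ^ n)%N.
    by apply/(dvdn_pfactor _ _ p_pr); rewrite -cardG cardSg ?der_sub.
  rewrite cardA cardG' cardZ m1 -expnD leq_exp2l // => le_n.
  (* [Q] has index [p] in [G']; since [n >= 3], its index in [G] is at most [p ^ 3]. *)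
  have [|Q [sQG' nQG cardQ]] := normal_pgroup (r := n.-1) pG (der_normal 1 G).
    by rewrite cardG' pfactorK // leq_pred.
  apply: (p2_in_cod_set_nonabelian_quotient p_pr pG nQG).
    rewrite -divgS ?normal_sub // cardG cardQ -expnB ?prime_gt0 //; last by lia.
    by rewrite dvdn_Pexp2l //; lia.
  apply/negP => /subset_leq_card; rewrite cardQ cardG' leq_exp2l //; lia.
apply: (p2_in_cod_set_nonabelian_quotient p_pr pG (center_normal G)) => //.
by rewrite idxZ m2.
Qed.

(** * Possible exponents and the final case analysis *)

Lemma one_in_cod_set (gT : finGroupType) (G : {group gT}) : 1 \in cod_set G.
Proof.
have := codegree_in_cod_set (0 : Iirr G).
by rewrite /codegree cfker_irr0 indexgg irr0 cfun11 divr1.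
Qed.

(** This reduces the theorem to deciding finitely many memberships. Exponent [n] would need [e = 0]
    and [k = n], a faithful linear character, which a nonabelian group does not have. *)
Lemma cod_set_prime_powers (p n : nat) (gT : finGroupType) (G : {group gT}) :
  prime p -> #|G| = (p ^ n)%N -> ~~ abelian G ->
  cod_set G =i
    [seq p%:R ^+ c | c <- iota 0 n & (p%:R ^+ c : algC) \in cod_set G].
Proof.
move=> p_pr cardG nabG x; have p_gt1 := prime_gt1 p_pr.
have pG : (p.-group G)%g by rewrite /pgroup cardG pnatX pnat_id.
apply/idP/mapP => [cod_x | [c]]; last by rewrite mem_filter => /andP[? _] ->.
have /imageP[i _ def_x] := cod_x.
have [k [e [idx deg cod i0P]]] := irr_pgroup_shape i p_pr pG.
exists (k - e)%N; last by rewrite def_x cod.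
rewrite mem_filter -cod -def_x cod_x mem_iota add0n /=.
have le_kn : (k <= n)%N.
  by rewrite -(dvdn_Pexp2l _ _ p_gt1) -idx -cardG dvdn_indexg.
have n_gt0 : (0 < n)%N.
  rewrite lt0n; apply: contra nabG => /eqP n0.
  by have /eqP := cardG; rewrite n0 -trivg_card1 => /eqP->; apply: abelian1.
have [i0 | e_gt0] := posnP e; last by lia.
rewrite i0 subn0 ltn_neqAle le_kn andbT; apply: contra nabG => /eqP kn.
rewrite (sameP derG1P trivgP).
have : ('chi_i \is a linear_char) by rewrite qualifE /= irr_char deg i0 expn0 eqxx.
rewrite lin_irr_der1 => /subset_trans; apply.
rewrite subG1 trivg_card1 -(eqn_pmul2r (indexg_gt0 G (cfker 'chi_i))).
by rewrite mul1n Lagrange ?cfker_sub // cardG idx kn.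
Qed.

(** A character nontrivial on [G'] has [e >= 1], and [e.*2 < k] gives [k - e > e]. *)
Lemma nonabelian_cod_set_ge2 (p : nat) (gT : finGroupType) (G : {group gT}) :
  prime p -> (p.-group G)%g -> ~~ abelian G ->
  exists2 c, (1 < c)%N & p%:R ^+ c \in cod_set G.
Proof.
move=> p_pr pG nabG.
have /subsetPn[x G'x ntx] : ~~ (G^`(1) \subset [1])%g.
  by apply: contra nabG; rewrite (sameP derG1P trivgP).
have [i [_ Kx]] := irr_kernel_separation (normal1 G) ntx.
have [k [e [_ deg cod i0P]]] := irr_pgroup_shape i p_pr pG.
have nz_i : i != 0.
  apply: contraNneq Kx => ->; rewrite cfker_irr0.
  by apply: subsetP G'x; apply: der_sub.
exists (k - e)%N; last by rewrite -cod codegree_in_cod_set.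
have e_gt0 : (0 < e)%N.
  rewrite lt0n; apply: contra Kx => /eqP e0; apply: subsetP G'x.
  by rewrite -lin_irr_der1 qualifE /= irr_char deg e0 expn0 eqxx.
by have := i0P nz_i; lia.
Qed.

Theorem theorem3p11 (p : nat) (gT : finGroupType) (G : {group gT})
    (p_prime : prime p) (p_odd : odd p)
    (pG : (p.-group G)%g) (nabG : ~~ abelian G) :
  [/\ #|G| = (p ^ 3)%N ->
        cod_set G =i [:: 1; p%:R; p%:R ^+ 2],
      #|G| = (p ^ 4)%N ->
        cod_set G =i [:: 1; p%:R; p%:R ^+ 2]
        \/ cod_set G =i [:: 1; p%:R; p%:R ^+ 3]
        \/ cod_set G =i [:: 1; p%:R; p%:R ^+ 2; p%:R ^+ 3]
    & #|G| = (p ^ 5)%N ->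
        cod_set G =i [:: 1; p%:R; p%:R ^+ 2]
        \/ cod_set G =i [:: 1; p%:R; p%:R ^+ 3]
        \/ cod_set G =i [:: 1; p%:R; p%:R ^+ 2; p%:R ^+ 3]
        \/ cod_set G =i [:: 1; p%:R; p%:R ^+ 2; p%:R ^+ 4]
        \/ cod_set G =i [:: 1; p%:R; p%:R ^+ 2; p%:R ^+ 3; p%:R ^+ 4]].
Proof.
have in0 : (p%:R ^+ 0 : algC) \in cod_set G := one_in_cod_set G.
have in1 : (p%:R ^+ 1 : algC) \in cod_set G := p_in_cod_set p_prime pG nabG.
have [c c_gt1 in_c] := nonabelian_cod_set_ge2 p_prime pG nabG.
have lt_c n : #|G| = (p ^ n)%N -> (c < n)%N.
  move=> cardG; move: in_c; rewrite (cod_set_prime_powers p_prime cardG nabG).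
  case/mapP=> d; rewrite mem_filter mem_iota => /andP[_ /=].
  move=> lt_dn /eqP; rewrite -!natrX eqr_nat eqn_exp2l ?prime_gt1 //.
  by move/eqP->.
split=> cardG; have lt_cn := lt_c _ cardG;
  have codE := cod_set_prime_powers p_prime cardG nabG; rewrite /= in0 in1 in codE.
- have c2 : c = 2 by lia.
  by rewrite c2 in in_c; rewrite in_c in codE.
- have [c2 | c3] : c = 2 \/ c = 3 by lia.
    by rewrite c2 in in_c; rewrite in_c in codE; case: ifP codE => _; auto.
  by rewrite c3 in in_c; rewrite in_c in codE; case: ifP codE => _; auto.
have p4_2 := p4_in_cod_set_p2 p_prime cardG.
(* With [p ^ 4] present, [p ^ 2] is too, and only [p ^ 3] stays undecided; without it, [c] is 2 or
   3. *)
have [in_4 | nin_4] := boolP (p%:R ^+ 4 \in cod_set G).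
  rewrite in_4 (p4_2 in_4) in codE.
  by case: ifP codE => _; auto 6.
rewrite (negPf nin_4) in codE.
have [c2 | [c3 | c4]] : c = 2 \/ c = 3 \/ c = 4 by lia.
- by rewrite c2 in in_c; rewrite in_c in codE; case: ifP codE => _; auto.
- by rewrite c3 in in_c; rewrite in_c in codE; case: ifP codE => _; auto.
by rewrite c4 (negPf nin_4) in in_c.
Qed.
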